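(* Let $X$ be a minimal h-homogeneous Stone space and let $h$ be a homeomorphism of $X$. Let $X_{\mathrm{per}}$ be the union of the finite $h$-orbits, $X_{\mathrm{aper}}$ the union of the infinite $h$-orbits, and $h_{\mathrm{aper}}$ the restriction of $h$ to $X_{\mathrm{aper}}$. Suppose that $X_{\mathrm{per}}$ is clopen and $(X_{\mathrm{per}},h)$ is strongly periodic, and that $(X_{\mathrm{aper}},h)$ is p.p.m. (allowing $X_{\mathrm{aper}}=\emptyset$). Then $h$ is p.p.m. and $o_{\min}(h)=o_{\min}(h_{\mathrm{aper}})$.
   Context: A homeomorphism $g$ of a Hausdorff space $X$ is minimal if $X\neq\emptyset$ and the only proper closed subset $K\subsetneq X$ with $gK\subseteq K$ is $K=\emptyset$. A zero-dimensional space $X$ is h-homogeneous if every nonempty clopen subset of $X$ is homeomorphic to $X$. A minimal h-homogeneous Stone space is an infinite compact Hausdorff h-homogeneous space admitting a minimal homeomorphism (e.g. the Cantor space). The topological full group $\tau[g]$ is the group of all homeomorphisms $h$ of $X$ for which there is a locally constant $c:X\to\mathbb{Z}$ with $hx=g^{c(x)}x$ for all $x$. For $g$ a minimal homeomorphism of an infinite compact Hausdorff space and $h\in\tau[g]$, the orbit number $o_g(h)$ is the number of infinite $h$-orbits contained in a $g$-orbit; this is finite and does not depend on the $g$-orbit. (It equals $o_g^+(h)+o_g^-(h)$, the numbers of positive and negative $h$-orbits in each $g$-orbit.) A homeomorphism $h$ of a compact Hausdorff space $X$ is piecewise a power of a minimal homeomorphism (p.p.m.) if $X=\emptyset$ or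 there is a minimal homeomorphism $g$ of $X$ with $h\in\tau[g]$. For $h$ p.p.m., $o_{\min}(h)$ is $0$ if $X$ is finite (including empty), and otherwise the least value of $o_g(h)$ over all minimal homeomorphisms $g$ of $X$ with $h\in\tau[g]$. A homeomorphism $h$ is strongly periodic on a compact Hausdorff space $Y$ if $G=\langle h\rangle$ is, i.e. there are finitely many distinct subgroups $K_1,\dots,K_n$ of finite index in $G$ such that for each $j$ the set of points with stabilizer conjugate to $K_j$ is clopen, and these sets partition $Y$; equivalently, $h$ has finite order on $Y$ and the fixed point set of each power of $h$ on $Y$ is clopen. *)

(* Defs.v *)
From HB Require Import structures.
From mathcomp Require Import all_boot all_order all_algebra.
From mathcomp Require Import all_classical topology.

Set Implicit Arguments.
Unset Strict Implicit.
Unset Printing Implicit Defensive.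

Local Open Scope classical_set_scope.

Record homeo (X Y : topologicalType) := Homeo {
  homeo_fun :> X -> Y;
  homeo_inv : Y -> X;
  homeoK : cancel homeo_fun homeo_inv;
  homeo_invK : cancel homeo_inv homeo_fun;
  homeo_continuous : continuous homeo_fun;
  homeo_inv_continuous : continuous homeo_inv }.

(* [set_type U] carries the subspace topology in the library, so this also
   applies to subsets. *)
Definition homeomorphic (X Y : topologicalType) : Prop := inhabited (homeo X Y).

Definition autohomeo (X : topologicalType) := homeo X X.

Section HomeoGroup.
Variable X : topologicalType.
Implicit Types f g h : autohomeo X.

Lemma autohomeoP f g : (f : X -> X) =1 g -> f = g.
Proof.
case: f g => [f f' fK f'K cf cf'] [g g' gK g'K cg cg'] /= /funext fg.
subst g; have f'g' : f' = g'.
  by apply/funext => x; rewrite -[in RHS](f'K x) gK.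
by subst g'; congr Homeo; exact: Prop_irrelevance.
Qed.

HB.instance Definition _ := gen_eqMixin (autohomeo X).
HB.instance Definition _ := gen_choiceMixin (autohomeo X).

Definition homeo_id : autohomeo X :=
  @Homeo X X id id (fun=> erefl) (fun=> erefl) (fun=> cvg_id) (fun=> cvg_id).

Lemma homeo_comp_continuous (f g : X -> X) :
  continuous f -> continuous g -> continuous (f \o g).
Proof.
by move=> cf cg x; apply: continuous_comp; [exact: cg|exact: cf].
Qed.

Definition homeo_comp f g : autohomeo X :=
  @Homeo X X (f \o g) (homeo_inv g \o homeo_inv f)
    (can_comp (@homeoK _ _ f) (@homeoK _ _ g))
    (can_comp (@homeo_invK _ _ g) (@homeo_invK _ _ f))
    (homeo_comp_continuous (@homeo_continuous _ _ f) (@homeo_continuous _ _ g))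
    (homeo_comp_continuous (@homeo_inv_continuous _ _ g)
       (@homeo_inv_continuous _ _ f)).

Definition homeo_sym f : autohomeo X :=
  @Homeo X X (homeo_inv f) f (@homeo_invK _ _ f) (@homeoK _ _ f)
    (@homeo_inv_continuous _ _ f) (@homeo_continuous _ _ f).

Lemma homeo_compA : associative homeo_comp.
Proof. by move=> f g h; exact: autohomeoP. Qed.

Lemma homeo_comp1 : left_id homeo_id homeo_comp.
Proof. by move=> f; exact: autohomeoP. Qed.

Lemma homeo_comp1r : right_id homeo_id homeo_comp.
Proof. by move=> f; exact: autohomeoP. Qed.

Lemma homeo_compV : left_inverse homeo_id homeo_sym homeo_comp.
Proof. by move=> f; apply: autohomeoP => x /=; exact: homeoK. Qed.

Lemma homeo_compVr : right_inverse homeo_id homeo_sym homeo_comp.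
Proof. by move=> f; apply: autohomeoP => x /=; exact: homeo_invK. Qed.

HB.instance Definition _ := isGroup.Build (autohomeo X)
  homeo_compA homeo_comp1 homeo_comp1r homeo_compV homeo_compVr.

End HomeoGroup.

Definition zpow (G : groupType) (g : G) (n : int) : G :=
  match n with Posz k => (g ^+ k)%g | Negz k => (g ^- k.+1)%g end.

Section Dynamics.
Variable X : topologicalType.
Implicit Types g h : autohomeo X.

Definition homeo_orbit h (x : X) : set X := [set zpow h n x | n in [set: int]].

Definition aper h : set X := [set x | infinite_set (homeo_orbit h x)].
Definition per h : set X := [set x | finite_set (homeo_orbit h x)].

Definition minimal_homeo g : Prop :=
  [set: X] !=set0 /\
  forall K : set X, closed K -> K != [set: X] -> g @` K `<=` K -> K = set0.

Definition locally_constant (T : Type) (c : X -> T) : Prop :=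
  forall x, \forall y \near x, c y = c x.

Definition topological_full_group g : set (autohomeo X) :=
  [set h | exists2 c : X -> int, locally_constant c &
                                 forall x, h x = zpow g (c x) x].

Definition infinite_orbits_in h (A : set X) : set (set X) :=
  [set O | [/\ exists x, O = homeo_orbit h x, infinite_set O & O `<=` A]].

(* For [g] minimal on an infinite compact Hausdorff space and [h] in its
   topological full group, the number below is finite and independent of the
   [g]-orbit, so that the default value 0 is not used. *)
Definition orbit_number g h : nat :=
  xget 0%N [set n | forall x,
    (infinite_orbits_in h (homeo_orbit g x) #= `I_n)%card].

(* Meant for compact Hausdorff spaces. *)
Definition ppm h : Prop :=
  [set: X] = set0 \/ exists2 g, minimal_homeo g & topological_full_group g h.

Definition orbit_numbers h : set nat :=
  [set n | exists g, [/\ minimal_homeo g, topological_full_group g h &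
                         n = orbit_number g h]].

(* The set of values is nonempty when [h] is p.p.m. and the space is infinite,
   so that it has a least element. *)
Definition omin h : nat :=
  if `[< finite_set [set: X] >] then 0%N
  else xget 0%N [set n | orbit_numbers h n /\ lbound (orbit_numbers h) n].

Definition cyclic_group h : set (autohomeo X) :=
  [set zpow h n | n in [set: int]].

Definition stabilizer (G : set (autohomeo X)) (x : X) : set (autohomeo X) :=
  [set f | G f /\ f x = x].

Definition left_coset (f : autohomeo X) (K : set (autohomeo X)) :
  set (autohomeo X) := [set (f * k)%g | k in K].

Definition finite_index_subgroup (G K : set (autohomeo X)) : Prop :=
  [/\ group_closed [in K], K `<=` G & finite_set [set left_coset f K | f in G]].

Definition points_of_type (G K : set (autohomeo X)) : set X :=
  [set x | exists2 f, G f & stabilizer G x = [set (k ^ f)%g | k in K]].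

Definition strongly_periodic (G : set (autohomeo X)) : Prop :=
  exists (n : nat) (K : 'I_n -> set (autohomeo X)),
    [/\ injective K,
        forall j, finite_index_subgroup G (K j),
        forall j, clopen (points_of_type G (K j)) &
        partition [set: 'I_n] (fun j => points_of_type G (K j)) [set: X]].

End Dynamics.

(* Zero-dimensionality is the existence of a base of clopen sets; the library's
   [zero_dimensional] only asks clopen sets to separate points. *)
Definition h_homogeneous (X : topologicalType) : Prop :=
  basis [set U : set X | clopen U] /\
  forall U : set X, clopen U -> U !=set0 -> homeomorphic (set_type U) X.

Definition minimal_h_homogeneous_Stone (X : topologicalType) : Prop :=
  [/\ infinite_set [set: X], compact [set: X], hausdorff_space X,
      h_homogeneous X & exists g : autohomeo X, minimal_homeo g].

Section Restriction.
Variables (X : topologicalType) (h : autohomeo X) (A : set X).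
Hypothesis hA : forall x, A (h x) <-> A x.

Lemma homeo_inv_invariant x : A (homeo_inv h x) <-> A x.
Proof. by rewrite -{2}(homeo_invK h x); apply: iff_sym. Qed.

Definition restrict_fun (f : X -> X) (fA : forall x, A (f x) <-> A x)
    (x : set_type A) : set_type A :=
  SigSub (mem_set ((fA (\val x)).2 (set_mem (valP x)))).

Lemma restrict_fun_continuous (f : X -> X) (fA : forall x, A (f x) <-> A x) :
  continuous f -> continuous (restrict_fun fA).
Proof.
move=> cf; apply: continuous_comp_initial => x.
apply: (@continuous_comp _ _ _ (set_val : set_type A -> X) f);
  [exact: initial_continuous|exact: cf].
Qed.

Lemma restrict_funK (f f' : X -> X) (fA : forall x, A (f x) <-> A x)
    (f'A : forall x, A (f' x) <-> A x) :
  cancel f f' -> cancel (restrict_fun fA) (restrict_fun f'A).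
Proof. by move=> fK x; apply: val_inj => /=; exact: fK. Qed.

Definition restrict_homeo : autohomeo (set_type A) :=
  @Homeo _ _ (restrict_fun hA) (restrict_fun homeo_inv_invariant)
    (restrict_funK hA homeo_inv_invariant (@homeoK _ _ h))
    (restrict_funK homeo_inv_invariant hA (@homeo_invK _ _ h))
    (restrict_fun_continuous (@homeo_continuous _ _ h))
    (restrict_fun_continuous (@homeo_inv_continuous _ _ h)).

End Restriction.

Section PerAper.
Variables (X : topologicalType) (h : autohomeo X).

Lemma zpowSr n x : zpow h (n + 1)%R x = zpow h n (h x).
Proof.
case: n => [n|[|n]].
- by rewrite -PoszD addn1 /zpow expgSr.
- by rewrite /= homeoK.
- have -> : (Negz n.+1 + 1 = Negz n)%R.
    by rewrite !NegzE -[n.+2]addn1 PoszD GRing.opprD GRing.addrNK.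
  by rewrite /zpow (expgS h n.+1) invgM /= homeoK.
Qed.

Lemma homeo_orbit_apply x : homeo_orbit h (h x) = homeo_orbit h x.
Proof.
apply/seteqP; split=> y /= [n _ <-].
- by exists (n + 1)%R => //; rewrite zpowSr.
- by exists (n - 1)%R => //; rewrite -zpowSr GRing.addrNK.
Qed.

Lemma per_invariant x : per h (h x) <-> per h x.
Proof. by rewrite /per /= homeo_orbit_apply. Qed.

Lemma aper_invariant x : aper h (h x) <-> aper h x.
Proof. by rewrite /aper /= homeo_orbit_apply. Qed.

Definition h_per : autohomeo (set_type (per h)) :=
  restrict_homeo per_invariant.
Definition h_aper : autohomeo (set_type (aper h)) :=
  restrict_homeo aper_invariant.

End PerAper.

(* Main.v *)
(* A minimal homeomorphism [g] of [X] induces on the clopen set [A] of aperiodic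
   points its first return map [g'], which is again minimal; since the orbits of
   [g'] are the traces of the orbits of [g], it has the same orbit number with
   respect to [h]. Conversely, strong periodicity and compactness give a clopen
   set [Y] meeting every finite [h]-orbit in exactly one point, and
   h-homogeneity gives a homeomorphism [phi] from [Y] to [A]. Given [g'] minimal
   on [A], let [g] go from [A] down to [Y] by the inverse of [phi], climb the
   [h]-orbits of the points of [Y], and come back to [A] by [phi] followed by
   [g'] when the climb returns to [Y]. The first return map of [g] to [A] is then
   [g'], so [g] is minimal, and [h] is locally a power of [g]. Hence the sets of
   orbit numbers of [h] and of its restriction to [A] coincide. When [A] is
   empty, a minimal homeomorphism of [Y], transported from [X], plays the role of
   [g']. *)
Require Import Defs.
From mathcomp Require Import all_boot all_algebra all_classical topology.
Local Open Scope classical_set_scope.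

Set Implicit Arguments.
Unset Strict Implicit.
Unset Printing Implicit Defensive.

Import GRing.Theory.

(** * Subspaces, compactness and clopen neighbourhoods *)

Section Subtype.
Variables (X : topologicalType) (A : set X).

Lemma val_continuous : continuous (val : set_type A -> X).
Proof. exact: initial_continuous. Qed.

Lemma near_val (t : set_type A) (P : X -> Prop) :
  (\forall x \near val t, P x) -> \forall u \near t, P (val u).
Proof. exact: val_continuous. Qed.

(** Openness of [A] lets a neighbourhood in the subspace serve in [X]. Quantifying over [u] with
    [val u = x] avoids choosing a membership proof for each [x]. *)
Lemma near_val_open (t : set_type A) (P : set_type A -> Prop) : open A ->
  (\forall u \near t, P u) ->
  \forall x \near val t, forall u : set_type A, val u = x -> P u.
Proof.
move=> oA [_ [[O oO <-] /= Ot OP]].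
have : nbhs (val t) O by exact: open_nbhs_nbhs.
by apply: filterS => x Ox u ux; apply: OP; rewrite -ux in Ox.
Qed.

Lemma accessible_set_type : accessible_space X -> accessible_space (set_type A).
Proof.
move=> aX; apply/accessible_finite_set_closed => B fB.
have -> : B = val @^-1` (val @` B).
  apply/seteqP; split => [x Bx|x [y By]]; first by exists x.
  by move=> /val_inj <-.
apply: closed_comp => [x _|]; first exact: val_continuous.
by move/accessible_finite_set_closed: aX; apply; exact: finite_image.
Qed.

End Subtype.

(** If [Q K] failed, the sets whose complement in [K] satisfies [Q] would form a proper filter, and
    a cluster point of it in [K] would contradict the local hypothesis. *)
Lemma compact_local_ind (X : topologicalType) (K : set X) (Q : set X -> Prop) :
  compact K -> Q set0 ->
  (forall U V, U `<=` V -> Q V -> Q U) ->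
  (forall U V, Q U -> Q V -> Q (U `|` V)) ->
  (forall x, K x -> exists2 U, nbhs x U & Q U) -> Q K.
Proof.
move=> cK Q0 Qmono QU Qloc; apply: contrapT => nQK.
pose F : set_system X := [set B | Q (K `\` B)].
have FF : ProperFilter F.
  split; first by rewrite /F /= setD0.
  split => [|B C FB FC|B C BC FB].
  - by rewrite /F /= setDT.
  - by rewrite /F /= setDIr; exact: QU.
  - by apply: Qmono FB => x [Kx nCx]; split => // /BC.
have FK : F K by rewrite /F /= setDv.
have [x [Kx cx]] := cK F FF FK.
have [U nU QU'] := Qloc x Kx.
have FU : F (~` U) by apply: Qmono QU' => y [_ /contrapT].
by have [y []] := cx _ _ FU nU.
Qed.

Lemma clopen_basis_nbhs (X : topologicalType) (x : X) (W : set X) :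
  basis [set U : set X | clopen U] -> nbhs x W ->
  exists U, [/\ clopen U, U x & U `<=` W].
Proof. by move=> [_ b] /b [U [cU Ux] UW]; exists U. Qed.

(** * Powers, orbits and full groups *)

Section Powers.
Variable X : topologicalType.
Implicit Types (g h : autohomeo X) (x y : X) (m n : int).

Lemma zpow_nat g (k : nat) x : zpow g k x = iter k g x.
Proof. by elim: k => //= k IH; rewrite expgS /= -IH. Qed.

Lemma zpowD g m n x : zpow g (m + n)%R x = zpow g m (zpow g n x).
Proof.
elim/int_rect: n x => [|n IH|n IH] x; first by rewrite addr0.
- by rewrite -addn1 PoszD addrA !zpowSr IH.
- rewrite -(homeo_invK g x) -addn1 PoszD opprD.
  have <- := zpowSr g (- n%:Z - 1)%R (homeo_inv g x).
  by rewrite addrA -zpowSr !addrNK IH.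
Qed.

Lemma zpowK g n : cancel (zpow g n) (zpow g (- n)%R).
Proof. by move=> x; rewrite -zpowD addNr. Qed.

Lemma zpowNK g n : cancel (zpow g (- n)%R) (zpow g n).
Proof. by move=> x; rewrite -zpowD addrN. Qed.

Lemma zpow_sym g n x : zpow (homeo_sym g) n x = zpow g (- n)%R x.
Proof.
have nat (k : nat) y : zpow (homeo_sym g) k y = zpow g (- k%:Z)%R y.
  apply: (can_inj (zpowK g k)); rewrite zpowNK !zpow_nat.
  by elim: k y => // k IH y; rewrite iterSr iterS /= homeo_invK.
case: n => k //; apply: (can_inj (zpowK (homeo_sym g) k.+1)).
by rewrite NegzE opprK zpowNK nat zpowK.
Qed.

Lemma orbitP g x y : homeo_orbit g x y <-> exists n, zpow g n x = y.
Proof. by split=> [[n _ <-]|[n <-]]; exists n. Qed.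

Lemma orbit_refl g x : homeo_orbit g x x.
Proof. by exists 0%R. Qed.

Lemma orbit_zpow g n x : homeo_orbit g (zpow g n x) = homeo_orbit g x.
Proof.
apply/seteqP; split=> y /orbitP[m <-]; apply/orbitP.
- by exists (m + n)%R; rewrite zpowD.
- by exists (m - n)%R; rewrite -zpowD addrNK.
Qed.

Lemma iter_inj g (k : nat) : injective (iter k g).
Proof. by elim: k => // k IH x y /= /(can_inj (@homeoK _ _ g)) /IH. Qed.

Lemma iter_continuous g (k : nat) : continuous (iter k g).
Proof.
elim: k => [|k IH] x /=; first exact: cvg_id.
by apply: continuous_comp; [exact: IH|exact: homeo_continuous].
Qed.

Lemma iter_near g (k : nat) x (P : X -> Prop) :
  (\forall y \near iter k g x, P y) -> \forall y \near x, P (iter k g y).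
Proof. exact: iter_continuous. Qed.

Lemma finite_orbit_period g x :
  finite_set (homeo_orbit g x) -> exists k, iter k.+1 g x = x.
Proof.
move=> forb; apply: contrapT => nper; apply: infinite_nat.
have injx : {in [set: nat] &, injective (fun k => iter k g x)}.
  suff lt i j : (i < j)%N -> iter i g x <> iter j g x.
    by move=> i j _ _ eij; case: (ltngtP i j) => // /lt; rewrite eij.
  move=> ltij eij; apply: nper; exists (j - i).-1.
  by rewrite prednK ?subn_gt0//; apply: (@iter_inj g i); rewrite -iterD subnKC 1?ltnW.
pose B := [set k : nat | homeo_orbit g x (iter k g x)].
suff : finite_set B by apply: sub_finite_set => k _; exists k => //; rewrite zpow_nat.
by apply: finite_preimage forb => i j _ _; apply: injx; exact: in_setT.
Qed.

(** A periodic point would have a finite forward orbit, which is closed, invariant and not all of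
    [X], against minimality. *)
Lemma minimal_zpow_inj g x m n :
  accessible_space X -> infinite_set [set: X] -> minimal_homeo g ->
  zpow g m x = zpow g n x -> m = n.
Proof.
move=> aX iX [_ gmin].
have per0 k : iter k.+1 g x <> x.
  move=> kx; pose K := [set iter i g x | i in `I_k.+1].
  have fK : finite_set K by exact: finite_image.
  have K0 : K = set0.
    apply: gmin; first by move/accessible_finite_set_closed: aX; apply.
      by apply/eqP => KT; apply: iX; rewrite -KT.
    move=> _ [_ [i ik <-] <-]; move: ik => /=; rewrite ltnS leq_eqVlt.
    case/predU1P => [->|ik]; last by exists i.+1.
    by exists 0%N => //=; rewrite -[RHS]kx.
  have : K x by exists 0%N.
  by rewrite K0.
have per1 (k : int) : zpow g k x = x -> k = 0%R.
  case: k => [[//|k]|k]; first by rewrite zpow_nat => /per0.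
  rewrite NegzE => kx; have := per0 k.
  by rewrite -zpow_nat -{1}kx zpowNK.
move=> e; apply: subr0_eq; apply: per1.
by rewrite addrC zpowD e zpowK.
Qed.

End Powers.

(* Locally a power of [g]; by [full_groupP], when [g] is minimal this is
   membership in the topological full group with the cocycle left implicit. *)
Definition locpow (X : topologicalType) (g : autohomeo X) (f : X -> X) (x : X) :=
  exists n : int, \forall y \near x, f y = zpow g n y.

Section LocalPowers.
Variables (X : topologicalType) (g : autohomeo X).
Implicit Types (f h : autohomeo X) (x : X).

Lemma locpow_zpow n x : locpow g (zpow g n) x.
Proof. by exists n; apply: nearW. Qed.

Lemma locpow_id x : locpow g id x.
Proof. exact: (locpow_zpow 0%R). Qed.

Lemma locpow_comp (f1 f2 : X -> X) x : {for x, continuous f2} ->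
  locpow g f1 (f2 x) -> locpow g f2 x -> locpow g (f1 \o f2) x.
Proof.
move=> cf2 [m f1m] [n f2n]; exists (m + n)%R.
have f1m' : nbhs x (f2 @^-1` [set y | f1 y = zpow g m y]).
  by apply: cf2; exact: f1m.
by apply: filterS2 f1m' f2n => y /= -> ->; rewrite zpowD.
Qed.

Lemma locpow_inv f x : locpow g f x -> locpow g (homeo_inv f) (f x).
Proof.
move=> [n fn]; exists (- n)%R.
have : nbhs (f x) (homeo_inv f @^-1` [set y | f y = zpow g n y]).
  by apply: homeo_inv_continuous; rewrite homeoK.
by apply: filterS => y /=; rewrite homeo_invK => {2}->; rewrite zpowK.
Qed.

(** The exponent of [f] in [h] is fixed near [x], so it is enough to compose finitely many local
    powers of [g], for [f] or for its inverse. *)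
Lemma locpow_trans f h : (forall x, locpow g f x) ->
  (forall x, locpow f h x) -> forall x, locpow g h x.
Proof.
move=> fg hf x; have [n hn] := hf x.
suff [m fm] : locpow g (zpow f n) x.
  by exists m; apply: filterS2 hn fm => y -> ->.
have nat f' (k : nat) : (forall x, locpow g f' x) -> forall x, locpow g (iter k f') x.
  move=> f'g; elim: k => [|k IH] y; first exact: locpow_id.
  apply: (@locpow_comp f' (iter k f')) => //; exact: iter_continuous.
case: n {hn} => k.
  by have [m hm] := nat f k fg x; exists m; apply: filterS hm => y; rewrite zpow_nat.
have fg' y : locpow g (homeo_sym f) y.
  by rewrite -(homeo_invK f y); exact: locpow_inv.
have [m hm] := nat (homeo_sym f) k.+1 fg' x; exists m.
by apply: filterS hm => y; rewrite NegzE -zpow_sym zpow_nat.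
Qed.

(* Minimality on an infinite space makes exponents unique, so that a pointwise
   choice of local exponents is automatically locally constant. *)
Lemma full_groupP h : accessible_space X -> infinite_set [set: X] ->
  minimal_homeo g -> topological_full_group g h <-> forall x, locpow g h x.
Proof.
move=> aX iX gmin; split=> [[c cl hc] x|hg].
  by exists (c x); apply: filterS (cl x) => y cy; rewrite hc cy.
have [c hc] := choice hg; exists c => [x|x]; last exact: nbhs_singleton (hc x).
apply: filterS (hc x) => y hy; apply: (minimal_zpow_inj aX iX gmin (x := y)).
by rewrite -hy; symmetry; exact: nbhs_singleton (hc y).
Qed.

End LocalPowers.

(** * First return maps *)

Lemma near_forall_lt (T : Type) (F : set_system T) (k : nat)
    (P : nat -> T -> Prop) : Filter F ->
  (forall i, (i < k)%N -> \forall x \near F, P i x) ->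
  \forall x \near F, forall i, (i < k)%N -> P i x.
Proof.
move=> FF; elim: k => [|k IH] FP; first exact: nearW.
apply: filterS2 (IH (fun i ik => FP i (ltnW ik))) (FP k (ltnSn k)) => x Px Pkx i.
by rewrite ltnS leq_eqVlt => /predU1P[->//|/Px].
Qed.

Lemma first_hit_unique (P : nat -> Prop) (k l : nat) :
  P k -> (forall i, (i < k)%N -> ~ P i) ->
  P l -> (forall i, (i < l)%N -> ~ P i) -> k = l.
Proof.
by move=> Pk nPk Pl nPl; case: (ltngtP k l) => // [/nPl|/nPk].
Qed.

Lemma first_hit_exists (P : nat -> Prop) : (exists k, P k) ->
  exists k, P k /\ forall i, (i < k)%N -> ~ P i.
Proof.
move=> exP; have exP' : exists k, `[< P k >].
  by have [k Pk] := exP; exists k; exact/asboolP.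
case: (ex_minnP exP') => k /asboolP Pk kmin; exists k; split => // i ik /asboolP/kmin.
by rewrite leqNgt ik.
Qed.

(** The return time is [k.+1], so time zero is not counted. As a relation it applies both to a map
    induced from [g] and to a map given beforehand. *)
Definition first_return (X : topologicalType) (g : X -> X) (A : set X)
    (f : set_type A -> set_type A) :=
  forall t, exists k, val (f t) = iter k.+1 g (val t) /\
    forall i, (i < k)%N -> ~ A (iter i.+1 g (val t)).

Section FirstReturnMap.
Variables (X : topologicalType) (A : set X).
Implicit Types (g : autohomeo X) (f : set_type A -> set_type A) (t : set_type A).

Lemma first_return_exists g : (forall x, A x -> exists n, A (iter n.+1 g x)) ->
  exists f, first_return g f.
Proof.
move=> rec; have : forall t, exists u : set_type A, exists k,
    val u = iter k.+1 g (val t) /\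
    forall i, (i < k)%N -> ~ A (iter i.+1 g (val t)).
  move=> t; have [k [Ak nA]] := first_hit_exists (rec _ (set_valP t)).
  by exists (SigSub (mem_set Ak)); exists k.
by move=> /choice[f fret]; exists f.
Qed.

(** The return time is locally constant: openness of [A] keeps the return, and closedness keeps the
    earlier misses. *)
Lemma first_return_near g f t : clopen A -> first_return g f ->
  exists k, (forall i, (i < k)%N -> ~ A (iter i.+1 g (val t))) /\
    \forall x \near val t, forall u, val u = x -> val (f u) = iter k.+1 g x.
Proof.
move=> [oA cA] fret; have [k [fk nA]] := fret t; exists k; split => //.
have Ak : \forall x \near val t, A (iter k.+1 g x).
  apply: iter_near; apply: open_nbhs_nbhs; split => //.
  by rewrite -fk; exact: set_valP.
have nAk : \forall x \near val t, forall i, (i < k)%N -> ~ A (iter i.+1 g x).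
  apply: near_forall_lt => i ik; apply: (@iter_near _ g i.+1 _ (~` A)).
  by apply: open_nbhs_nbhs; split; [exact: closed_openC|exact: nA].
apply: filterS2 Ak nAk => x Akx nAx u ux.
have [l [fl nAl]] := fret u; rewrite ux in fl nAl.
suff -> : k = l by [].
apply: (@first_hit_unique (fun k => A (iter k.+1 g x))) => //.
by rewrite -fl; exact: set_valP.
Qed.

Lemma first_return_continuous g f : clopen A -> first_return g f -> continuous f.
Proof.
move=> clA fret; apply: continuous_comp_initial => t W /= Wt.
have [k [_ fk]] := first_return_near t clA fret.
have fkt := nbhs_singleton fk _ erefl.
have kW : nbhs (val t) (iter k.+1 g @^-1` W).
  by apply: (@iter_near _ g k.+1 _ W); rewrite -fkt.
by apply: filterS2 (near_val fk) (near_val kW) => u /= fu; rewrite /set_val /= fu.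
Qed.

Lemma iter_homeo_sym g (k l : nat) x : (k <= l)%N ->
  iter k (homeo_sym g) (iter l g x) = iter (l - k) g x.
Proof.
move=> kl; apply: (@iter_inj _ g k); rewrite -iterD subnKC //.
elim: k (iter l g x) {kl} => // k IH y.
by rewrite iterSr iterS /= homeo_invK.
Qed.

(** The path from [t] to its first return, read backwards, is a first return path of the inverse. *)
Lemma first_return_cancel g f f' :
  first_return g f -> first_return (homeo_sym g) f' -> cancel f f'.
Proof.
move=> fret f'ret t; have [k [fk nAk]] := fret t.
have [l [fl nAl]] := f'ret (f t); apply: val_inj.
suff e : k = l by rewrite fl -e fk iter_homeo_sym // subnn.
apply: (@first_hit_unique (fun k => A (iter k.+1 (homeo_sym g) (val (f t))))) => //.
- by rewrite fk iter_homeo_sym // subnn; exact: set_valP.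
- move=> i ik; rewrite fk iter_homeo_sym ?ltnS 1?ltnW // subSS.
  rewrite -(prednK (n := k - i)) ?subn_gt0//.
  by apply: nAk; rewrite prednK ?subn_gt0 // leq_subr.
- by rewrite -fl; exact: set_valP.
Qed.

End FirstReturnMap.

(** The points that never enter [A] form a closed forward invariant set, proper because [A] is
    nonempty. *)
Lemma minimal_visits (X : topologicalType) (g : autohomeo X) (A : set X) :
  minimal_homeo g -> open A -> A !=set0 -> forall x, exists n, A (iter n g x).
Proof.
move=> [_ gmin] oA [a Aa] x; apply: contrapT => nA.
pose K := \bigcap_(n in [set: nat]) (iter n g @^-1` (~` A)).
have K0 : K = set0.
  apply: gmin.
  - apply: closed_bigI => n _; apply: closed_comp; last exact: open_closedC.
    by move=> y _; exact: iter_continuous.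
  - by apply/eqP => KT; have : K a by [rewrite KT]; move=> /(_ 0%N I).
  - by move=> _ [y Ky <-] n _ /=; rewrite -iterSr; exact: Ky.
by have : K x; [move=> n _ An; apply: nA; exists n|rewrite K0].
Qed.

(* Uniform bounds are what gives visits in backward time. *)
Lemma minimal_visits_bounded (X : topologicalType) (g : autohomeo X) (A : set X) :
  compact [set: X] -> minimal_homeo g -> open A -> A !=set0 ->
  exists N, forall x, exists2 n, (n <= N)%N & A (iter n g x).
Proof.
move=> cX gmin oA A0.
pose Q (U : set X) := exists N, forall x, U x -> exists2 n, (n <= N)%N & A (iter n g x).
suff [N hN] : Q [set: X] by exists N => x; exact: hN.
apply: compact_local_ind => //.
- by exists 0%N.
- by move=> U V UV [N hN]; exists N => x /UV/hN.
- move=> U V [M hM] [N hN]; exists (maxn M N) => x [/hM|/hN] [n nle An];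
    by exists n => //; rewrite leq_max nle ?orbT.
- move=> x _; have [n An] := minimal_visits gmin oA A0 x.
  exists (iter n g @^-1` A); last by exists n => y Ay; exists n.
  by apply: iter_near; exact: open_nbhs_nbhs.
Qed.

Section FirstReturnHomeo.
Variables (X : topologicalType) (g : autohomeo X) (A : set X).

Lemma first_return_homeo : compact [set: X] -> minimal_homeo g ->
  clopen A -> A !=set0 -> exists g' : autohomeo (set_type A), first_return g g'.
Proof.
move=> cX gmin clA A0; have [oA cA] := clA.
have [f fret] : exists f : set_type A -> set_type A, first_return g f.
  apply: first_return_exists => x _.
  have [n An] := minimal_visits gmin oA A0 (g x).
  by exists n; rewrite iterSr.
have [f' f'ret] : exists f : set_type A -> set_type A, first_return (homeo_sym g) f.
  apply: first_return_exists => x _.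
  (* The point [N.+1] steps before [x] enters [A] within [N] steps, hence strictly before [x]; this
     gives a return in backward time. *)
  have [N hN] := minimal_visits_bounded cX gmin oA A0.
  have [n nN An] := hN (iter N.+1 (homeo_sym g) x).
  exists (N - n)%N; rewrite -subSn //.
  suff <- : iter n g (iter N.+1 (homeo_sym g) x) = iter (N.+1 - n) (homeo_sym g) x by [].
  by rewrite -(@iter_homeo_sym _ (homeo_sym g)) 1?leqW.
exists (Homeo (first_return_cancel fret f'ret)
  (first_return_cancel (g := homeo_sym g) f'ret fret)
  (first_return_continuous clA fret) (first_return_continuous clA f'ret)).
exact: fret.
Qed.

Variable g' : autohomeo (set_type A).
Hypothesis g'ret : first_return g g'.

(** The trace on [A] of a closed invariant [K] is invariant under [g']. If it is all of [A], then
    [K] is all of [X] by the third hypothesis; if it is empty, so is [K] by the second. *)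
Lemma first_return_minimal_ext : minimal_homeo g' ->
  (forall x, exists k, A (iter k g x)) ->
  (forall x, exists2 a, A a & exists k, iter k g a = x) -> minimal_homeo g.
Proof.
move=> [[t _] g'min] visit from; split; first by exists (val t).
move=> K cK KT gK.
have iterK k x : K x -> K (iter k g x).
  by move=> Kx; elim: k => // k IH; apply: gK; exists (iter k g x).
have K0 : val @^-1` K = set0 :> set (set_type A).
  apply: g'min.
  - by apply: closed_comp => // u _; exact: val_continuous.
  - apply/eqP => K'T; move/eqP: KT; apply; apply/seteqP; split => // x _.
    have [a Aa [k <-]] := from x; apply: iterK.
    have : (val @^-1` K) (SigSub (mem_set Aa)) by rewrite K'T.
    by [].
  - by move=> _ [u Ku <-] /=; have [k [-> _]] := g'ret u; exact: iterK.
apply/seteqP; split => // x Kx; have [k Ak] := visit x.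
have : (val @^-1` K) (SigSub (mem_set Ak)) by exact: iterK.
by rewrite K0.
Qed.

Hypothesis clA : clopen A.

(** Strong induction on [n], removing one first return at a time; the number [m] of returns is the
    same near [t] because return times are locally constant. *)
Lemma first_return_steps_near (n : nat) (t : set_type A) : A (iter n g (val t)) ->
  exists m : nat, \forall u \near t, iter n g (val u) = val (iter m g' u).
Proof.
elim/ltn_ind: n t => n IH t An.
have [n0|n0] := posnP n; first by exists 0%N; apply: (@nearW _ (nbhs t)) => u; rewrite n0.
have [k [nAk gk]] := first_return_near t clA g'ret.
(* Time [n] is itself a visit, so it cannot come before the first return at time [k.+1]. *)
have kn : (k < n)%N.
  by rewrite ltnNge; apply/negP => nk; apply: (nAk n.-1); rewrite prednK.
have e u : val (g' u) = iter k.+1 g (val u) ->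
    iter n g (val u) = iter (n - k.+1) g (val (g' u)).
  by move=> ->; rewrite -iterD subnK.
have lt : (n - k.+1 < n)%N by rewrite ltn_subrL.
have [|m mE] := IH _ lt (g' t); first by rewrite -e // (nbhs_singleton gk).
exists m.+1; have mE' := @iter_near _ g' 1 t _ mE.
by apply: filterS2 (near_val gk) mE' => u guk um; rewrite iterSr e // guk.
Qed.

Lemma first_return_steps (n : nat) t : A (iter n g (val t)) ->
  exists m : nat, iter n g (val t) = val (iter m g' t).
Proof.
by move=> /first_return_steps_near[m mE]; exists m; exact: nbhs_singleton mE.
Qed.

(** Nonnegative powers suffice in both directions, since a negative power becomes positive when the
    two points are exchanged. *)
Lemma first_return_orbit t u :
  homeo_orbit g (val t) (val u) <-> homeo_orbit g' t u.
Proof.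
split.
  suff nat (n : nat) v w : iter n g (val v) = val w -> homeo_orbit g' v w.
    move=> /orbitP[[n|n]].
      by rewrite zpow_nat => /nat.
    rewrite NegzE => e; have : iter n.+1 g (val u) = val t.
      by rewrite -zpow_nat -e zpowNK.
    by move=> /nat /orbitP[m <-]; rewrite orbit_zpow; exact: orbit_refl.
  move=> e; have [|m mE] := @first_return_steps n v.
    by rewrite e; exact: set_valP.
  apply/orbitP; exists m; rewrite zpow_nat; apply: val_inj.
  by rewrite -mE.
suff nat (n : nat) v : homeo_orbit g (val v) (val (iter n g' v)).
  move=> /orbitP[[n|n] <-]; first by rewrite zpow_nat.
  rewrite NegzE; pose w := zpow g' (- n.+1%:Z)%R t; rewrite -/w.
  have -> : t = iter n.+1 g' w by rewrite -zpow_nat /w zpowNK.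
  by have /orbitP[m <-] := nat n.+1 w; rewrite orbit_zpow; exact: orbit_refl.
elim: n => [|n IH]; first exact: orbit_refl.
have [k [/= -> _]] := g'ret (iter n g' v).
move: IH => /orbitP[m <-]; apply/orbitP; exists (k.+1%:Z + m)%R.
by rewrite zpowD zpow_nat.
Qed.

Lemma first_return_minimal : minimal_homeo g -> A !=set0 -> minimal_homeo g'.
Proof.
move=> gmin A0; have [oA cA] := clA; have [_ gminK] := gmin; split.
  by have [a Aa] := A0; exists (SigSub (mem_set Aa)).
move=> K cK KT g'K.
(* [B] is [K] together with the complement of [A]; it is closed because [A] is open. *)
pose B : set X := [set x | forall t, val t = x -> K t].
have cB : closed B.
  rewrite -openC openE => x /= /existsNP[t /not_implyP[tx nK]].
  have := near_val_open oA (open_nbhs_nbhs (conj (closed_openC cK) nK)).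
  rewrite /= tx; rewrite /interior.
  have Ax : nbhs x A by rewrite -tx; apply: open_nbhs_nbhs; split => //; exact: set_valP.
  apply: filterS2 Ax => y Ay nKy By.
  by apply: (nKy (SigSub (mem_set Ay)) erefl); exact: By.
(* [L] is the largest forward [g]-invariant set whose trace on [A] is in [K]. *)
pose L := \bigcap_(n in [set: nat]) (iter n g @^-1` B).
(* The forward [g]-orbit of a point of [K] meets [A] only in iterates of [g'], which stay in [K]. *)
have KL t : K t -> L (val t).
  move=> Kt n _ u ux; have [|m mE] := @first_return_steps n t.
    by rewrite -ux; exact: set_valP.
  have -> : u = iter m g' t by apply: val_inj; rewrite -mE.
  by elim: m {mE} => // m IH; apply: g'K; exists (iter m g' t).
have L0 : L = set0.
  apply: gminK.
  - apply: closed_bigI => n _; apply: closed_comp => // y _.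
    exact: iter_continuous.
  - apply/eqP => LT; move/eqP: KT; apply; apply/seteqP; split => // t _.
    by have : L (val t) by [rewrite LT]; move=> /(_ 0%N I t erefl).
  - by move=> _ [y Ly <-] n _ /=; rewrite -iterSr; exact: Ly.
by apply/seteqP; split => // t /KL; rewrite L0.
Qed.

End FirstReturnHomeo.

Lemma zpow_semiconj (T X : topologicalType) (k : autohomeo T) (h : autohomeo X)
    (p : T -> X) : (forall t, p (k t) = h (p t)) ->
  forall n t, p (zpow k n t) = zpow h n (p t).
Proof.
move=> pk; have nat (n : nat) t : p (iter n k t) = iter n h (p t).
  by elim: n => //= n IH; rewrite pk IH.
move=> [n|n] t; first by rewrite !zpow_nat.
rewrite NegzE; apply: (can_inj (zpowK h n.+1)).
by rewrite zpowNK zpow_nat -nat -zpow_nat zpowNK.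
Qed.

(** * Extension by the identity and restriction *)

Lemma near_eq_continuous_at (X Y : topologicalType) (f k : X -> Y) x :
  (\forall y \near x, f y = k y) -> {for x, continuous k} ->
  {for x, continuous f}.
Proof.
move=> fk ck W; rewrite (nbhs_singleton fk) => /ck kW.
by apply: filterS2 fk kW => y /= ->.
Qed.

Lemma continuous_at_open_val (X Y : topologicalType) (A : set X) (f : X -> Y)
    (t : set_type A) : open A -> {for t, continuous (f \o val : set_type A -> Y)} ->
  {for val t, continuous f}.
Proof.
move=> oA cf W /cf /(near_val_open oA) fW.
have At : nbhs (val t) A by apply: open_nbhs_nbhs; split => //; exact: set_valP.
by apply: filterS2 fW At => y + Ay => /(_ (SigSub (mem_set Ay)) erefl).
Qed.

Section Extension.
Variables (X : topologicalType) (A : set X).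

(** Values in [X] rather than in [A] allow the same extension to send [A] onto another clopen
    set. *)
Definition ext_fun (f : set_type A -> X) (x : X) : X :=
  if pselect (A x) is left Ax then f (SigSub (mem_set Ax)) else x.

Lemma ext_fun_val f t : ext_fun f (val t) = f t.
Proof.
rewrite /ext_fun; case: pselect => [Ax|/(_ (set_valP t))//].
by congr f; exact: val_inj.
Qed.

Lemma ext_fun_out f x : ~ A x -> ext_fun f x = x.
Proof. by rewrite /ext_fun; case: pselect. Qed.

Lemma ext_fun_continuous f : clopen A -> continuous f -> continuous (ext_fun f).
Proof.
move=> [oA cA] cf x; have [Ax|nAx] := pselect (A x).
  rewrite -[x]/(val (SigSub (mem_set Ax) : set_type A)).
  apply: continuous_at_open_val => //.
  by rewrite (_ : _ \o _ = f) //; [exact: cf|apply/funext => t; exact: ext_fun_val].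
apply: (@near_eq_continuous_at _ _ _ id); last exact: cvg_id.
have : nbhs x (~` A) by apply: open_nbhs_nbhs; split => //; exact: closed_openC.
by apply: filterS => y; exact: ext_fun_out.
Qed.

Lemma ext_funK (f f' : set_type A -> set_type A) : cancel f f' ->
  cancel (ext_fun (val \o f)) (ext_fun (val \o f')).
Proof.
move=> fK x; have [Ax|nAx] := pselect (A x); last by rewrite !ext_fun_out.
rewrite -[x]/(val (SigSub (mem_set Ax) : set_type A)).
by rewrite ext_fun_val; apply: etrans (ext_fun_val _ (f _)) _; rewrite /= fK.
Qed.

Hypothesis clA : clopen A.

Lemma ext_fun_val_continuous (f : set_type A -> set_type A) :
  continuous f -> continuous (ext_fun (val \o f)).
Proof.
move=> cf; apply: ext_fun_continuous => // x.
by apply: continuous_comp; [exact: cf|exact: val_continuous].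
Qed.

Definition ext_homeo (f : autohomeo (set_type A)) : autohomeo X :=
  Homeo (ext_funK (@homeoK _ _ f)) (ext_funK (@homeo_invK _ _ f))
    (ext_fun_val_continuous (@homeo_continuous _ _ f))
    (ext_fun_val_continuous (@homeo_inv_continuous _ _ f)).

Implicit Types f g : autohomeo (set_type A).

Lemma ext_homeo_val f t : ext_homeo f (val t) = val (f t).
Proof. exact: ext_fun_val. Qed.

Lemma ext_homeo_out f x : ~ A x -> ext_homeo f x = x.
Proof. exact: ext_fun_out. Qed.

Lemma ext_homeo_in f x : A (ext_homeo f x) <-> A x.
Proof.
have [Ax|nAx] := pselect (A x); last by rewrite ext_homeo_out.
rewrite -[x]/(val (SigSub (mem_set Ax) : set_type A)) ext_homeo_val.
by split => _; exact: set_valP.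
Qed.

Lemma locpow_ext g f : (forall t, locpow g f t) ->
  forall x, locpow (ext_homeo g) (ext_homeo f) x.
Proof.
move=> gf x; have [oA cA] := clA; have [Ax|nAx] := pselect (A x); last first.
  exists 0%R.
  have : nbhs x (~` A) by apply: open_nbhs_nbhs; split => //; exact: closed_openC.
  by apply: filterS => y nAy; rewrite ext_homeo_out.
pose t : set_type A := SigSub (mem_set Ax); have [n fn] := gf t; exists n.
have Anx : nbhs (val t) A by exact: open_nbhs_nbhs.
apply: filterS2 (near_val_open oA fn) Anx => y + Ay.
move=> /(_ (SigSub (mem_set Ay)) erefl) e.
rewrite -[y]/(val (SigSub (mem_set Ay) : set_type A)) ext_homeo_val e.
by apply: zpow_semiconj => u; rewrite ext_homeo_val.
Qed.

Lemma first_return_locpow_ext (g : autohomeo X) f : first_return g f ->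
  forall x, locpow g (ext_homeo f) x.
Proof.
move=> fret x; have [oA cA] := clA; have [Ax|nAx] := pselect (A x); last first.
  exists 0%R.
  have : nbhs x (~` A) by apply: open_nbhs_nbhs; split => //; exact: closed_openC.
  by apply: filterS => y nAy; rewrite ext_homeo_out.
pose t : set_type A := SigSub (mem_set Ax).
have [k [_ fk]] := first_return_near t clA fret; exists k.+1.
have Anx : nbhs (val t) A by exact: open_nbhs_nbhs.
apply: filterS2 fk Anx => y + Ay => /(_ (SigSub (mem_set Ay)) erefl).
by rewrite -ext_homeo_val zpow_nat.
Qed.

End Extension.

(** * Traces on a clopen set: local powers and orbit numbers *)

Section Restriction.
Variables (X : topologicalType) (A : set X).
Implicit Types g h : autohomeo X.

Lemma ext_restrict h (hA : forall x, A (h x) <-> A x) (clA : clopen A) x :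
  A x -> ext_homeo clA (restrict_homeo hA) x = h x.
Proof.
by move=> Ax; rewrite -[x]/(val (SigSub (mem_set Ax) : set_type A)) ext_homeo_val.
Qed.

Lemma restrict_orbit h (hA : forall x, A (h x) <-> A x) t :
  homeo_orbit h (val t) = val @` homeo_orbit (restrict_homeo hA) t.
Proof.
have vz n u : val (zpow (restrict_homeo hA) n u) = zpow h n (val u).
  exact: zpow_semiconj.
apply/seteqP; split => [x /orbitP[n <-]|_ [u /orbitP[n <-] <-]].
  by exists (zpow (restrict_homeo hA) n t); rewrite ?vz //; apply/orbitP; exists n.
by apply/orbitP; exists n; rewrite vz.
Qed.

Variables (g : autohomeo X) (g' : autohomeo (set_type A)).
Hypotheses (clA : clopen A) (g'ret : first_return g g').

(** A nonnegative power of [g] joining points of [A] is locally a power of [g']. A negative exponent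
    is treated by passing to the inverse of [h], near the image point. *)
Lemma locpow_restrict h (hA : forall x, A (h x) <-> A x) :
  (forall x, locpow g h x) -> forall t, locpow g' (restrict_homeo hA) t.
Proof.
move=> gh.
have nonneg (k : autohomeo X) (kA : forall x, A (k x) <-> A x) (n : nat)
    (t : set_type A) :
    (\forall x \near val t, k x = iter n g x) -> locpow g' (restrict_homeo kA) t.
  move=> kn; have [|m mE] := first_return_steps_near g'ret clA (n := n) (t := t).
    by rewrite -(nbhs_singleton kn); apply/kA; exact: set_valP.
  exists m; apply: filterS2 (near_val kn) mE => u ku um.
  by apply: val_inj; rewrite zpow_nat -um.
move=> t; have [[n|n] hn] := gh (val t).
  by apply: (nonneg _ _ n); apply: filterS hn => x; rewrite zpow_nat.
pose k := restrict_homeo (homeo_inv_invariant hA : forall x, A (homeo_sym h x) <-> A x).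
have gk : locpow g' k (restrict_homeo hA t).
  apply: (nonneg _ _ n.+1).
  have : nbhs (h (val t)) (homeo_inv h @^-1` [set y | h y = zpow g (Negz n) y]).
    by apply: homeo_inv_continuous; rewrite homeoK.
  apply: filterS => x hx; rewrite -[x in RHS](homeo_invK h).
  have -> : h (homeo_inv h x) = zpow g (Negz n) (homeo_inv h x) by exact: hx.
  by rewrite -zpow_nat NegzE zpowNK.
have := locpow_inv gk; rewrite (_ : k _ = t); last by apply: val_inj; exact: homeoK.
move=> [m mE]; exists m; apply: filterS mE => u <-.
exact: val_inj.
Qed.

(** All infinite [h]-orbits lie in [A], and [g']-orbits are the traces of [g]-orbits, so [val] maps
    one family of infinite orbits bijectively onto the other. *)
Lemma orbit_number_first_return h (hA : forall x, A (h x) <-> A x) :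
  (forall x, exists k, A (iter k g x)) -> (forall x, aper h x -> A x) ->
  orbit_number g h = orbit_number g' (restrict_homeo hA).
Proof.
move=> visit aperA.
have trace t : infinite_orbits_in h (homeo_orbit g (val t)) =
    (fun O => val @` O) @` infinite_orbits_in (restrict_homeo hA) (homeo_orbit g' t).
  apply/seteqP; split.
  - move=> O [[x ->] inf sub]; have Ax := aperA x inf.
    pose u : set_type A := SigSub (mem_set Ax).
    have e := restrict_orbit hA u; rewrite [val u]/= in e.
    exists (homeo_orbit (restrict_homeo hA) u); last by rewrite -e.
    split; [by exists u| |].
    + by move=> fin; apply: inf; rewrite e; exact: finite_image.
    + move=> v vu; apply/(first_return_orbit g'ret clA); apply: sub.
      by rewrite e; exists v.
  - move=> _ [_ [[u ->] inf sub] <-]; rewrite -restrict_orbit.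
    split; [by exists (val u)| |].
    + move=> fin; apply: inf; move: fin; rewrite restrict_orbit => fin.
      rewrite (_ : homeo_orbit _ u =
        val @^-1` (val @` homeo_orbit (restrict_homeo hA) u)).
        by apply: finite_preimage fin => v w _ _; exact: val_inj.
      apply/seteqP; split => [v uv|v [w uw /val_inj <-]//]; by exists v.
    + rewrite (restrict_orbit hA) => _ [v /sub tv <-].
      exact/(first_return_orbit g'ret clA).
have inj : injective (fun O : set (set_type A) => val @` O).
  move=> O O' e; apply/seteqP; split => t Ot.
    have : (val @` O) (val t) by exists t.
    by rewrite e => -[u O'u /val_inj <-].
  have : (val @` O') (val t) by exists t.
  by rewrite -e => -[u O'u /val_inj <-].
have card t n : (infinite_orbits_in h (homeo_orbit g (val t)) #= `I_n)%card =
    (infinite_orbits_in (restrict_homeo hA) (homeo_orbit g' t) #= `I_n)%card.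
  by rewrite trace; apply: card_eql; apply: inj_card_eq => O O' _ _; exact: inj.
rewrite /orbit_number; congr xget; apply/seteqP; split => n /= cn.
  by move=> t; rewrite -card.
move=> x; have [k Ak] := visit x; rewrite -(orbit_zpow g k) zpow_nat.
by rewrite -[iter k g x]/(val (SigSub (mem_set Ak) : set_type A)) card.
Qed.

End Restriction.

(** * Towers over a transversal of the periodic part *)

Section Tower.
Variables (X : topologicalType) (h s G : autohomeo X) (P Y : set X).
Hypotheses (clP : clopen P) (clY : clopen Y) (YP : Y `<=` P)
  (hP : forall x, P (h x) <-> P x)
  (Yvisit : forall x, P x -> exists n, Y (iter n h x))
  (Yper : forall x n, Y x -> Y (iter n h x) -> iter n h x = x)
  (sP : forall x, P x -> s x = h x) (sN : forall x, ~ P x -> s x = x)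
  (GP : forall x, P x -> ~ Y x -> G x = x).

(* [s] moves along [h] on [P] and fixes the rest; [G] acts only at the bottom of
   the towers, on [Y], and off [P]. *)
Definition tower : autohomeo X := homeo_comp G s.

Lemma iterP n x : P (iter n h x) <-> P x.
Proof. by elim: n => //= n IH; rewrite hP. Qed.

Lemma tower_climb n x : P x -> (forall i, (i < n)%N -> ~ Y (iter i.+1 h x)) ->
  iter n tower x = iter n h x.
Proof.
move=> Px; elim: n => // n IH nY.
rewrite iterS IH => [|i ilt]; last by apply: nY; rewrite ltnS ltnW.
by rewrite /= sP ?iterP // GP //; [rewrite hP iterP|exact: (nY n)].
Qed.

Lemma tower_top k x : P x -> (forall i, (i < k)%N -> ~ Y (iter i.+1 h x)) ->
  iter k.+1 tower x = G (iter k.+1 h x).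
Proof. by move=> Px nY; rewrite iterS tower_climb //= sP ?iterP. Qed.

Lemma transversal_first_hit x : P x -> exists k, Y (iter k.+1 h x) /\
  forall i, (i < k)%N -> ~ Y (iter i.+1 h x).
Proof.
move=> Px; apply: (@first_hit_exists (fun k => Y (iter k.+1 h x))).
have [|n Yn] := @Yvisit (h x); first exact/hP.
by exists n; rewrite iterSr.
Qed.

(** By [Yper] the climb from [y] comes back to [Y] at [y] itself, and only the factor [G] remains to
    be applied. *)
Lemma tower_round y : Y y -> exists k, iter k.+1 tower y = G y /\
  forall i, (i < k)%N -> P (iter i.+1 tower y) /\ ~ Y (iter i.+1 tower y).
Proof.
move=> Yy; have Py := YP Yy; have [k [Yk nY]] := transversal_first_hit Py.
exists k; split; first by rewrite tower_top // Yper.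
move=> i ik; rewrite tower_climb => // [|j ji].
  by split; [exact/iterP|exact: nY].
by apply: nY; exact: leq_trans ji _.
Qed.

Lemma tower_visits x : P x -> exists k y, Y y /\ iter k tower x = G y.
Proof.
move=> Px; have [k [Yk nY]] := transversal_first_hit Px.
by exists k.+1, (iter k.+1 h x); rewrite tower_top.
Qed.

Lemma transversal_period x : P x -> exists k, iter k.+1 h x = x.
Proof.
move=> Px; have [n Yn] := Yvisit Px.
have [k [Yk _]] := transversal_first_hit (YP Yn); exists k.
apply: (@iter_inj _ h n); rewrite -iterD addnC iterD; exact: Yper.
Qed.

Lemma tower_from x : P x -> exists y k, Y y /\ iter k tower y = x.
Proof.
move=> Px; have [n Yn] := Yvisit Px; have [k kx] := transversal_period Px.
pose y := iter n h x.
have : exists m, iter m h y = x.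
  (* Since [k.+1] is a period of [x], so is [n * k.+1], and [n] of these steps are already used to
     reach [y]. *)
  exists (n * k.+1 - n)%N; rewrite -iterD subnK ?leq_pmulr //.
  by elim: n {Yn y} => // n IH; rewrite mulSn iterD IH.
(* With [m] least the climb avoids [Y]: meeting [Y] again means being back at [y], and a shorter
   climb would do. *)
move=> /first_hit_exists[m [mx nm]]; exists y, m; split => //.
rewrite tower_climb //; first exact: YP.
move=> i im Yi; have iy := Yper Yn Yi.
apply: (nm (m - i.+1)%N); first by rewrite ltn_subrL (leq_trans _ im).
rewrite -/y in iy; by rewrite -{1}iy -iterD subnK.
Qed.

(** Three cases: off [P] the exponent is 0; inside a tower it is 1; at the top, where [h x] lies in
    [Y], [s] falls back to the bottom and the climb has to be undone. *)
Lemma locpow_tower x : locpow tower s x.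
Proof.
have [[oP cP] [oY cY]] := (clP, clY).
have nearP : P x -> \forall z \near x, P z.
  by move=> Px; exact: open_nbhs_nbhs.
have [Px|nPx] := pselect (P x); last first.
  exists 0%R; have : nbhs x (~` P).
    by apply: open_nbhs_nbhs; split => //; exact: closed_openC.
  by apply: filterS => z; exact: sN.
have [Yhx|nYhx] := pselect (Y (h x)); last first.
  exists 1%R.
  have nYn : \forall z \near x, (~` Y) (h z).
    apply: (@iter_near _ h 1 x (~` Y)).
    by apply: open_nbhs_nbhs; split => //; exact: closed_openC.
  apply: filterS2 (nearP Px) nYn => z Pz nYz.
  by rewrite (zpow_nat tower 1) tower_top // sP // GP //; apply/hP.
(* The period of [h x] is [k.+1], so [k] climbs lead from [h x] up to [x]. The visits and misses
   recorded below keep [k] constant near [x]. *)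
have [k [Yk nY]] := transversal_first_hit (YP Yhx).
exists (- k%:Z)%R.
have Yn : \forall z \near x, Y (h z).
  by apply: (@iter_near _ h 1 x Y); exact: open_nbhs_nbhs.
have Ykn : \forall z \near x, Y (iter k.+1 h (h z)).
  apply: filterS (@iter_near _ h k.+2 x Y _) => [z|]; first by rewrite iterSr.
  by apply: open_nbhs_nbhs; split => //; rewrite iterSr.
have nYn : \forall z \near x, forall i, (i < k)%N -> ~ Y (iter i.+1 h (h z)).
  apply: near_forall_lt => i ik.
  apply: filterS (@iter_near _ h i.+2 x (~` Y) _) => [z|]; first by rewrite iterSr.
  apply: open_nbhs_nbhs; split; first exact: closed_openC.
  by rewrite iterSr; exact: nY.
apply: filterS3 (nearP Px) Yn (filterI Ykn nYn) => z Pz Yz [Ykz nYz].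
have zk : zpow tower k (h z) = z.
  have Phz := YP Yz; rewrite zpow_nat tower_climb //.
  by apply: (@iter_inj _ h 1); rewrite -iterD add1n; exact: Yper.
by rewrite sP // -[in RHS]zk zpowK.
Qed.

End Tower.

(** * An involution exchanging two disjoint clopen sets *)

Section Swap.
Variables (X : topologicalType) (A Y : set X).
Hypotheses (clA : clopen A) (clY : clopen Y) (AY : A `&` Y = set0).
Variable phi : homeo (set_type A) (set_type Y).

Let into : set_type A -> X := val \o phi.
Let back : set_type Y -> X := val \o homeo_inv phi.

(** Thanks to the extension by the identity, the second branch covers both [Y] and the points
    outside the two sets. *)
Let f x := if `[< A x >] then ext_fun into x else ext_fun back x.

Lemma exists_swap : exists2 sigma : autohomeo X, involutive sigma &
  [/\ forall x, A x -> Y (sigma x), forall x, Y x -> A (sigma x) &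
      forall x, ~ A x -> ~ Y x -> sigma x = x].
Proof.
have YnA x : Y x -> ~ A x.
  by move=> Yx Ax; have : (A `&` Y) x by []; rewrite AY.
have fA (t : set_type A) : f (val t) = val (phi t).
  by rewrite /f asboolT ?ext_fun_val //; exact: set_valP.
have fY (u : set_type Y) : f (val u) = val (homeo_inv phi u).
  by rewrite /f asboolF ?ext_fun_val //; apply: YnA; exact: set_valP.
have fN x : ~ A x -> ~ Y x -> f x = x.
  by move=> nA nY; rewrite /f asboolF // ext_fun_out.
have finv : involutive f.
  move=> x; have [Ax|nAx] := pselect (A x).
    rewrite -[x]/(val (SigSub (mem_set Ax) : set_type A)).
    by rewrite fA fY homeoK.
  have [Yx|nYx] := pselect (Y x); last by rewrite !fN.
  rewrite -[x]/(val (SigSub (mem_set Yx) : set_type Y)).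
  by rewrite fY fA homeo_invK.
have fcont : continuous f.
  have ci : continuous into.
    by move=> t; apply: continuous_comp; [exact: homeo_continuous|exact: val_continuous].
  have cb : continuous back.
    move=> t; apply: continuous_comp; last exact: val_continuous.
    exact: homeo_inv_continuous.
  move=> x; have [oA cA] := clA; have [Ax|nAx] := pselect (A x).
    apply: (@near_eq_continuous_at _ _ _ (ext_fun into)).
      have : nbhs x A by exact: open_nbhs_nbhs.
      by apply: filterS => y Ay; rewrite /f asboolT.
    exact: ext_fun_continuous.
  apply: (@near_eq_continuous_at _ _ _ (ext_fun back)).
    have : nbhs x (~` A) by apply: open_nbhs_nbhs; split => //; exact: closed_openC.
    by apply: filterS => y nAy; rewrite /f asboolF.
  exact: ext_fun_continuous.
exists (@Homeo X X f f finv finv fcont fcont); first exact: finv.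
split => [x Ax|x Yx|x]; last exact: fN.
  rewrite -[x]/(val (SigSub (mem_set Ax) : set_type A)).
  by rewrite [homeo_fun _ _]fA; exact: set_valP.
rewrite -[x]/(val (SigSub (mem_set Yx) : set_type Y)).
by rewrite [homeo_fun _ _]fY; exact: set_valP.
Qed.

End Swap.

(** * Existence of a clopen transversal *)

Lemma iter_modn (T : Type) (f : T -> T) (p n : nat) x :
  iter p f x = x -> iter n f x = iter (n %% p) f x.
Proof.
move=> fpx; rewrite {1}(divn_eq n p) addnC iterD; congr iter.
by elim: (n %/ p) => // q IH; rewrite mulSn iterD IH.
Qed.

(** The cyclic group is commutative, so conjugation is trivial and the stabilizer is constant on
    each clopen set of points of a given type. *)
Lemma strongly_periodic_near (X : topologicalType) (h : autohomeo X) (x : X) :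
  strongly_periodic (cyclic_group h) ->
  \forall y \near x, forall n, zpow h n y = y <-> zpow h n x = x.
Proof.
move=> [N [K [_ Kfin Kcl [Kcov _ _]]]].
have type j y : points_of_type (cyclic_group h) (K j) y ->
    stabilizer (cyclic_group h) y = K j.
  move=> [f [m _ <-] ->]; have [_ KG _] := Kfin j.
  rewrite -[RHS]image_id; apply: eq_imagel => k /KG[n _ <-] /=.
  rewrite conjgE; suff -> : (zpow h n * zpow h m = zpow h m * zpow h n)%g.
    by rewrite mulgA mulVg mul1g.
  by apply: autohomeoP => z /=; rewrite -!zpowD addrC.
have [j _ xj] : cover [set: 'I_N] (fun j => points_of_type (cyclic_group h) (K j)) x.
  by rewrite Kcov.
have : nbhs x (points_of_type (cyclic_group h) (K j)).
  by apply: open_nbhs_nbhs; split => //; case: (Kcl j).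
apply: filterS => y yj n.
have stabE z : stabilizer (cyclic_group h) z (zpow h n) <-> zpow h n z = z.
  by split=> [[]//|e]; split => //; exists n.
by rewrite -stabE (type _ _ yj) -(type _ _ xj) stabE.
Qed.

Section Transversal.
Variables (X : topologicalType) (h : autohomeo X).

(** Forward visits suffice: when the points of [Y] are periodic this is the union of the orbits
    meeting [Y]. *)
Definition saturation (Y : set X) := [set x | exists n, Y (iter n h x)].

(** Partial transversals, with at most one point in each orbit, can be built locally and then
    joined. The common period [p] makes their saturations clopen. *)
Definition transversal (Y : set X) := [/\ clopen Y,
  exists2 p, (0 < p)%N & forall y, Y y -> iter p h y = y &
  forall y n, Y y -> Y (iter n h y) -> iter n h y = y].

Lemma iter_return (p n : nat) x : (0 < p)%N -> iter p h x = x ->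
  exists m, iter m h (iter n h x) = x.
Proof.
move=> p0 px; exists (n * p - n)%N; rewrite -iterD subnK ?leq_pmulr//.
by rewrite (iter_modn _ px) modnMl.
Qed.

(** Visits to [Y] can be looked for among the times below the common period, so never meeting [Y] is
    an open condition. *)
Lemma saturation_clopen Y : transversal Y -> clopen (saturation Y).
Proof.
move=> [[oY cY] [p p0 pY] _]; split.
  have -> : saturation Y = \bigcup_(n in [set: nat]) (iter n h @^-1` Y).
    by apply/seteqP; split => [x [n Yn]|x [n _ Yn]]; exists n.
  apply: bigcup_open => n _; apply: open_comp => // x _; exact: iter_continuous.
rewrite -openC openE => x nYx.
have : \forall z \near x, forall n, (n < p)%N -> ~ Y (iter n h z).
  apply: near_forall_lt => n _; apply: (@iter_near _ h n x (~` Y)).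
  apply: open_nbhs_nbhs; split; first exact: closed_openC.
  by move=> Yn; apply: nYx; exists n.
apply: filterS => z nYz [n Yn]; apply: (nYz (n %% p)%N); first by rewrite ltn_mod.
rewrite -iter_modn //; apply: (@iter_inj _ h n).
by rewrite -iterD addnC iterD pY.
Qed.

(** The orbits already met by [Y1] are removed from [Y2]; clopenness of the saturation keeps the
    union clopen, and the product of the periods is a common one. *)
Lemma transversal_setU Y1 Y2 : transversal Y1 -> transversal Y2 ->
  exists2 Y, transversal Y & saturation Y1 `|` saturation Y2 `<=` saturation Y.
Proof.
move=> tY1 tY2; have [oS cS] := saturation_clopen tY1.
have [[oY1 cY1] [p p0 pY1] inj1] := tY1; have [[oY2 cY2] [q q0 qY2] inj2] := tY2.
exists (Y1 `|` (Y2 `\` saturation Y1)); last first.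
  move=> x [[n Yn]|[n Yn]]; first by exists n; left.
  have [[m Ym]|nS] := pselect (saturation Y1 (iter n h x)).
    by exists (m + n)%N; left; rewrite iterD.
  by exists n; right.
split.
- rewrite setDE; split.
    by apply: openU => //; apply: openI => //; exact: closed_openC.
  by apply: closedU => //; apply: closedI => //; exact: open_closedC.
- exists (p * q)%N; first by rewrite muln_gt0 p0.
  move=> y [Yy|[Yy _]].
    by rewrite (iter_modn _ (pY1 y Yy)) modnMr.
  by rewrite (iter_modn _ (qY2 y Yy)) modnMl.
- move=> y n [Yy|[Yy nSy]] [Yn|[Yn nSn]].
  + exact: inj1.
  + have [m my] := iter_return n p0 (pY1 y Yy).
    by exfalso; apply: nSn; exists m; rewrite my.
  + by exfalso; apply: nSy; exists n.
  + exact: inj2.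
Qed.

Hypotheses (hX : hausdorff_space X) (bX : basis [set U : set X | clopen U])
  (Pcl : clopen (per h)) (Hsp : strongly_periodic (cyclic_group (h_per h))).

Lemma per_near x : per h x ->
  \forall y \near x, forall n, zpow h n y = y <-> zpow h n x = x.
Proof.
move=> Px; have [oP _] := Pcl; pose t : set_type (per h) := SigSub (mem_set Px).
have NP : nbhs x (per h) by exact: open_nbhs_nbhs.
apply: filterS2 (near_val_open oP (strongly_periodic_near t Hsp)) NP => y + Py n.
move=> /(_ (SigSub (mem_set Py)) erefl n) [fx fy].
have vz (u : set_type (per h)) : val (zpow (h_per h) n u) = zpow h n (val u).
  exact: zpow_semiconj.
split => e.
  by have := vz t; rewrite fx // -?vz //; apply: val_inj; rewrite vz.
have := vz (SigSub (mem_set Py) : set_type (per h)).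
by rewrite fy //; apply: val_inj; rewrite vz.
Qed.

(** If [x] has least period [d.+1], nearby points have that period too because stabilizers are
    locally constant, and separating [x] from its other [d] translates gives a neighbourhood that no
    orbit meets twice. *)
Lemma local_transversal x : per h x ->
  exists2 Y, Y x & transversal Y.
Proof.
move=> Px; have [oP _] := Pcl; have hX' := hX; rewrite open_hausdorff in hX'.
have [d [dx nd]] := first_hit_exists (finite_orbit_period Px).
have /choice[V hV] : forall i, exists V : set X, (i < d)%N -> nbhs x V /\
    forall z, V z -> ~ V (iter i.+1 h z).
  move=> i; have [id|] := boolP (i < d)%N; last by exists set0.
  have /eqP nx : x <> iter i.+1 h x by move=> /esym; exact: nd.
  have [[B C] /= [/set_mem Bx /set_mem Cx] [oB oC BC]] := hX' _ _ nx.
  exists (B `&` (iter i.+1 h @^-1` C)) => _; split.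
    apply: filterI; first exact: open_nbhs_nbhs.
    by apply: (@iter_near _ h i.+1 x C); exact: open_nbhs_nbhs.
  move=> z [_ Cz] [Bz _].
  by have : (B `&` C) (iter i.+1 h z) by []; rewrite (eqP BC).
have Vn : \forall z \near x, forall i, (i < d)%N -> V i z.
  by apply: near_forall_lt => i /hV[].
have NP : nbhs x (per h) by exact: open_nbhs_nbhs.
have [U [cU Ux UW]] := clopen_basis_nbhs bX (filterI NP (filterI Vn (per_near Px))).
have Uper y : U y -> iter d.+1 h y = y.
  by move=> /UW[_ [_ /(_ d.+1)]]; rewrite !zpow_nat => ->.
exists U => //; split => //; first by exists d.+1.
move=> y n Uy; rewrite (iter_modn n (Uper y Uy)).
have : (n %% d.+1 < d.+1)%N by rewrite ltn_mod.
case: (n %% d.+1)%N => // i; rewrite ltnS => id Ui; exfalso.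
have [_ nV] := hV i id; apply: (nV y).
  by have [_ [Vy _]] := UW _ Uy; exact: Vy.
by have [_ [Vy _]] := UW _ Ui; exact: Vy.
Qed.

Lemma transversal_exists : compact [set: X] ->
  exists Y, [/\ Y `<=` per h, per h `<=` saturation Y & transversal Y].
Proof.
move=> cX.
pose Q (C : set X) := exists Y, C `<=` saturation Y /\ transversal Y.
have [Y [PY tY]] : Q (per h).
  apply: compact_local_ind.
  - by apply: (subclosed_compact _ cX) => //; case: Pcl.
  - exists set0; split => //; split => //; last by exists 1%N.
    by split; [exact: open0|exact: closed0].
  - by move=> U V UV [Y [VY tY]]; exists Y; split => //; exact: subset_trans VY.
  - move=> U V [Y1 [UY1 tY1]] [Y2 [VY2 tY2]].
    have [Y tY sub] := transversal_setU tY1 tY2; exists Y; split => //.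
    by apply: subset_trans sub; exact: setUSS.
  - move=> x Px; have [Y Yx tY] := local_transversal Px; exists Y.
      by apply: open_nbhs_nbhs; split => //; case: tY => -[].
    by exists Y; split => // y Yy; exists 0%N.
exists Y; split => //.
move=> y Yy; have [_ [p p0 /(_ y Yy) py] _] := tY.
apply: (@sub_finite_set _ _ [set iter i h y | i in `I_p]); last exact: finite_image.
move=> _ [[n|n] _ <-].
  by rewrite zpow_nat (iter_modn _ py); exists (n %% p)%N => //; rewrite /= ltn_mod.
(* A backward iterate of [y] also has period [p], so it is a forward iterate of [y]. *)
rewrite NegzE.
have [m my] : exists m, iter m h (zpow h (- n.+1%:Z)%R y) = y.
  by exists n.+1; rewrite -zpow_nat zpowNK.
have : iter p h (zpow h (- n.+1%:Z)%R y) = zpow h (- n.+1%:Z)%R y.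
  by rewrite -zpow_nat -zpowD addrC zpowD zpow_nat py.
move=> /(iter_return m p0)[k <-]; rewrite my (iter_modn _ py).
by exists (k %% p)%N => //; rewrite /= ltn_mod.
Qed.

End Transversal.

(** * Transport of minimality along a homeomorphism *)

Section Conjugation.
Variables (X Y : topologicalType).

Definition homeo_inverse (f : homeo X Y) : homeo Y X :=
  Homeo (@homeo_invK _ _ f) (@homeoK _ _ f)
    (@homeo_inv_continuous _ _ f) (@homeo_continuous _ _ f).

Lemma continuous_compose (Z : topologicalType) (f : Y -> Z) (g : X -> Y) :
  continuous f -> continuous g -> continuous (f \o g).
Proof.
by move=> cf cg x; apply: continuous_comp; [exact: cg|exact: cf].
Qed.

Definition homeo_trans (Z : topologicalType) (f : homeo X Y) (g : homeo Y Z) :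
    homeo X Z :=
  Homeo (can_comp (@homeoK _ _ g) (@homeoK _ _ f))
    (can_comp (@homeo_invK _ _ f) (@homeo_invK _ _ g))
    (continuous_compose (@homeo_continuous _ _ g) (@homeo_continuous _ _ f))
    (fun z => @continuous_comp _ _ _ _ _ z (@homeo_inv_continuous _ _ g z)
       (@homeo_inv_continuous _ _ f _)).

End Conjugation.

Lemma minimal_homeo_transport (X Y : topologicalType) (f : homeo X Y)
    (g : autohomeo Y) :
  minimal_homeo g -> exists g' : autohomeo X, minimal_homeo g'.
Proof.
move=> [[y _] gmin].
pose g' : autohomeo X := homeo_trans (homeo_trans f g) (homeo_inverse f).
exists g'; split; first by exists (homeo_inv f y).
move=> K cK KT g'K.
have K0 : homeo_inv f @^-1` K = set0.
  apply: gmin.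
  - by apply: closed_comp => // z _; exact: homeo_inv_continuous.
  - apply/eqP => KT'; move/eqP: KT; apply; apply/seteqP; split => // x _.
    have : (homeo_inv f @^-1` K) (f x) by rewrite KT'.
    by rewrite /= homeoK.
  - move=> _ [z Kz <-] /=; apply: g'K; exists (homeo_inv f z) => //.
    by rewrite /= homeo_invK.
apply/seteqP; split => // x Kx.
have : (homeo_inv f @^-1` K) (f x) by rewrite /= homeoK.
by rewrite K0.
Qed.

(** * Comparison of the orbit numbers *)

(** Towers over [Y] fill all of [X]. A minimal [g'] on [Y], which is homeomorphic to [X], acts at
    the bottom and is the first return map of the tower to [Y]. *)
Lemma minimal_extension_per (X : topologicalType) (h : autohomeo X) :
  minimal_h_homogeneous_Stone X -> aper h = set0 -> clopen (per h) ->
  strongly_periodic (cyclic_group (h_per h)) ->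
  exists2 g, minimal_homeo g & forall x, locpow g h x.
Proof.
move=> [iX cX hX [bX hom] [g0 g0min]] A0 Pcl Hsp.
have [Y [YP PY [clY _ Yper]]] := transversal_exists hX bX Pcl Hsp cX.
have PT x : per h x.
  by apply: contrapT => nPx; have : aper h x by []; rewrite A0.
have hP x : per h (h x) <-> per h x by exact: per_invariant.
have Y0 : Y !=set0.
  by have [[x _] _] := g0min; have [n Yn] := PY x (PT x); exists (iter n h x).
have [phi] := hom Y clY Y0.
have [g' g'min] := minimal_homeo_transport phi g0min.
pose G := ext_homeo clY g'.
have sP x : per h x -> h x = h x by [].
have sN x : ~ per h x -> h x = x by move=> /(_ (PT x)).
have GP x : per h x -> ~ Y x -> G x = x by move=> _; exact: ext_homeo_out.
exists (tower h G); last first.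
  by move=> x; apply: (locpow_tower Pcl clY YP hP PY Yper sP sN GP).
have g'ret : first_return (tower h G) g'.
  move=> t; have [k [kt nY]] := tower_round YP hP PY Yper sP GP (set_valP t).
  by exists k; rewrite kt ext_homeo_val; split => // i /nY[].
apply: (first_return_minimal_ext g'ret g'min) => x.
  have [k [y [Yy ky]]] := tower_visits hP PY sP GP (PT x).
  by exists k; rewrite ky; exact/ext_homeo_in.
have [y [k [Yy kx]]] := tower_from YP hP PY Yper sP GP (PT x).
by exists y => //; exists k.
Qed.

Lemma minimal_extension_aper (X : topologicalType) (h : autohomeo X)
    (g' : autohomeo (set_type (aper h))) :
  minimal_h_homogeneous_Stone X -> clopen (per h) ->
  strongly_periodic (cyclic_group (h_per h)) ->
  minimal_homeo g' -> (forall t, locpow g' (h_aper h) t) ->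
  exists g, [/\ minimal_homeo g, first_return g g' & forall x, locpow g h x].
Proof.
move=> [iX cX hX [bX hom] _] Pcl Hsp g'min hg'.
have [Y [YP PY [clY _ Yper]]] := transversal_exists hX bX Pcl Hsp cX.
have hP x : per h (h x) <-> per h x by exact: per_invariant.
have clA : clopen (aper h).
  by split; [apply: closed_openC|apply: open_closedC]; case: Pcl.
pose s := ext_homeo Pcl (h_per h).
have sP x : per h x -> s x = h x by exact: ext_restrict.
have sN x : ~ per h x -> s x = x by exact: ext_homeo_out.
(* [sigma] exchanges [aper h] and [Y], both homeomorphic to [X]. If [Y] is empty no such exchange
   exists and the identity is taken. *)
have [sigma [sigmaK sigmaN sigmaY sigmaA]] : exists sigma : autohomeo X,
    [/\ involutive sigma, forall x, per h x -> ~ Y x -> sigma x = x,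
        forall y, Y y -> aper h (sigma y) &
        (forall x, sigma x = x) \/ (forall x, aper h x -> Y (sigma x))].
  have [Y0|/set0P Y0] := eqVneq Y set0.
    by exists (homeo_id X); split => //; [rewrite Y0|left].
  have A0 : aper h !=set0 by have [[t _] _] := g'min; exists (val t); exact: set_valP.
  have [phi] := hom _ clA A0; have [psi] := hom _ clY Y0.
  have AY : aper h `&` Y = set0.
    by apply/seteqP; split => // x [Ax /YP Px].
  have [sigma sigmaK [sA sY sN']] :=
    exists_swap clA clY AY (homeo_trans phi (homeo_inverse psi)).
  exists sigma; split => //; last by right.
  by move=> x Px; apply: sN' => Ax.
(* When [Y] is nonempty, [G] drops from [aper h] to [Y], where the extension of [g'] is trivial;
   from [Y] it goes back by [sigma] and then applies [g']. *)
pose G := homeo_comp (ext_homeo clA g') sigma.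
have GE x : G x = ext_homeo clA g' (sigma x) by [].
have GP x : per h x -> ~ Y x -> G x = x.
  by move=> Px nYx; rewrite GE sigmaN //; apply: ext_homeo_out => Ax; exact: Ax.
have g'ret : first_return (tower s G) g'.
  move=> t; have At := set_valP t.
  have gt : tower s G (val t) = ext_homeo clA g' (sigma (val t)).
    by rewrite -GE -[in RHS](sN (val t)).
  case: sigmaA => [sigma1|/(_ _ At) Yt].
    by exists 0%N; split => //; rewrite (gt : iter 1 _ _ = _) sigma1 ext_homeo_val.
  have Pt : per h (sigma (val t)) by exact: YP.
  have gst : tower s G (val t) = sigma (val t).
    by rewrite gt ext_homeo_out // => A'; exact: A'.
  have [k [kt nY]] := tower_round YP hP PY Yper sP GP Yt.
  (* One step down to [Y] and [k.+1] steps around the tower make the return time [k.+2]. *)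
  exists k.+1; split.
    by rewrite iterSr gst kt GE sigmaK ext_homeo_val.
  move=> [|i] ik; rewrite iterSr gst; first by apply.
  by have [Pi _] := nY i ik; apply.
exists (tower s G); split => //.
- apply: (first_return_minimal_ext g'ret g'min) => x;
    (have [Px|Ax] := pselect (per h x); last first).
  + by exists 0%N.
  + have [k [y [Yy ky]]] := tower_visits hP PY sP GP Px; exists k; rewrite ky.
    by apply/(ext_homeo_in clA g' (sigma y)); exact: sigmaY.
  + by exists x => //; exists 0%N.
  + have [y [k [Yy kx]]] := tower_from YP hP PY Yper sP GP Px.
    have Ay := sigmaY y Yy; exists (sigma y) => //; exists k.+1; rewrite iterSr -kx.
    rewrite (_ : tower s G _ = G (s (sigma y))) // (sN _ Ay) GE sigmaK.
    rewrite ext_homeo_out // => A'.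
    by apply: A'; exact: YP.
(* [h] is [s] followed by the extension of its aperiodic part; the first is locally a power of the
   tower, and so is the second, through the first return map [g']. *)
- have hE x : h x = ext_homeo clA (h_aper h) (s x).
    have [Px|Ax] := pselect (per h x).
      by rewrite sP // ext_homeo_out // => A'; apply: A'; apply/hP.
    by rewrite sN // ext_restrict.
  have gs x : locpow (tower s G) s x.
    exact: (locpow_tower Pcl clY YP hP PY Yper sP sN GP).
  have gA : forall x, locpow (tower s G) (ext_homeo clA (h_aper h)) x.
    apply: (locpow_trans (f := ext_homeo clA g')).
      exact: first_return_locpow_ext.
    exact: locpow_ext.
  move=> x; have [n nE] := locpow_comp (@homeo_continuous _ _ s x) (gA (s x)) (gs x).
  by exists n; apply: filterS nE => y <-; rewrite hE.
Qed.

Lemma infinite_aper (X : topologicalType) (h : autohomeo X) :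
  aper h !=set0 -> infinite_set [set: set_type (aper h)].
Proof.
move=> [x Ax] fin; apply: (Ax); pose t : set_type (aper h) := SigSub (mem_set Ax).
rewrite -[x]/(val t) (restrict_orbit (@aper_invariant _ h)).
by apply: finite_image; exact: sub_finite_set fin.
Qed.

(** Inducing on [aper h] gives one inclusion and the tower construction the other; each keeps the
    orbit number, as the two maps are related by first return. *)
Lemma orbit_numbers_aper (X : topologicalType) (h : autohomeo X) :
  minimal_h_homogeneous_Stone X -> clopen (per h) ->
  strongly_periodic (cyclic_group (h_per h)) -> aper h !=set0 ->
  orbit_numbers h = orbit_numbers (h_aper h).
Proof.
move=> HX Pcl Hsp A0; have [iX cX hX _ _] := HX.
have aX := hausdorff_accessible hX.
have aA := @accessible_set_type _ (aper h) aX.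
have iA := infinite_aper A0.
have clA : clopen (aper h).
  by split; [apply: closed_openC|apply: open_closedC]; case: Pcl.
have visit g : minimal_homeo g -> forall x, exists k, aper h (iter k g x).
  by move=> gmin; apply: minimal_visits => //; case: clA.
apply/seteqP; split => n [g [gmin gh ->]].
- have [g' g'ret] := first_return_homeo cX gmin clA A0.
  have g'min := first_return_minimal g'ret clA gmin A0.
  exists g'; split => //.
  + apply/full_groupP => //; apply: (locpow_restrict clA g'ret).
    exact/(full_groupP _ aX iX gmin).
  + exact: (orbit_number_first_return clA g'ret (@aper_invariant _ h) (visit g gmin)).
- have hg : forall t, locpow g (h_aper h) t by exact/(full_groupP _ aA iA gmin).
  have [g' [g'min ret hg']] := minimal_extension_aper HX Pcl Hsp gmin hg.
  exists g'; split => //; first exact/full_groupP.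
  symmetry.
  exact: (orbit_number_first_return clA ret (@aper_invariant _ h) (visit g' g'min)).
Qed.

Theorem proposition7p1 (X : topologicalType) (h : autohomeo X)
  (HX : minimal_h_homogeneous_Stone X)
  (Hper : clopen (per h))
  (Hsp : strongly_periodic (cyclic_group (h_per h)))
  (Haper : ppm (h_aper h)) :
  ppm h /\ omin h = omin (h_aper h).
Proof.
have [iX _ hX _ _] := HX; have aX := hausdorff_accessible hX.
(* If there are aperiodic points, both minima are taken over the same set. *)
have [A0|/set0P A0] := eqVneq (aper h) set0; last first.
  have e := orbit_numbers_aper HX Hper Hsp A0; have iA := infinite_aper A0.
  split; last by rewrite /omin !asboolF // e.
  case: Haper => [AT|[g gmin gh]].
    by exfalso; apply: iA; rewrite AT.
  have : orbit_numbers (h_aper h) (orbit_number g (h_aper h)) by exists g.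
  by rewrite -e => -[g' [g'min g'h _]]; right; exists g'.
have [g gmin hg] := minimal_extension_per HX A0 Hper Hsp.
have gh : topological_full_group g h by exact/full_groupP.
split; first by right; exists g.
(* Without infinite orbits the number 0 is the actual count for every [g'], not a default value. *)
have on0 g' : orbit_number g' h = 0%N.
  have noinf B : infinite_orbits_in h B = set0.
    apply/seteqP; split => // O [[x ->] inf _].
    by have : aper h x by []; rewrite A0.
  apply: xget_unique => [x|n hn].
    by rewrite noinf II0.
  have [[x _] _] := gmin; have := hn x; rewrite noinf => /card_esym.
  by rewrite card_eq0 => /eqP/IIn_eq0.
(* The aperiodic part is empty, hence finite, so its [omin] is 0 by definition. *)
rewrite {1}/omin asboolF // [RHS]/omin asboolT; last first.
  rewrite (_ : [set: _] = set0) //; apply/seteqP; split => // t _.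
  have At : aper h (val t) by exact: set_valP.
  suff sub0 : aper h `<=` set0 by exact: sub0 At.
  by rewrite A0.
apply: xget_unique => [|n [[g' [_ _ ->]] _]]; last exact: on0.
by split; [exists g|move=> n _].
Qed.
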